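(* Let $S$ be a polygonal surface in $\mathbb{R}^2$, let $F(S)$ be its framework, and let $w$ be a self-stress on $F(S)$. Let $f,f'$ be faces of $S$. Then the lift $\tau_{\gamma,w}(f,f')$ does not depend on the choice of the oriented face-path $\gamma$ from $f$ to $f'$ within its class of homotopic oriented face-paths: if $\gamma$ and $\gamma'$ are homotopic oriented face-paths from $f$ to $f'$, then $\tau_{\gamma,w}(f,f')=\tau_{\gamma',w}(f,f')$.
   Context: Polygonal surfaces. A polygon in $\mathbb{R}^n$ is flat if all its vertices lie in one two-dimensional plane and its boundary has no self-intersections (it need not be convex). A polygonal surface (with boundary) in $\mathbb{R}^n$, $n\ge 2$, is a mapping of a CW-complex of a surface (with boundary) to $\mathbb{R}^n$ such that each face corresponds to a flat polygon. Self-intersections of the image are allowed. Surfaces are compact, and their boundary is homeomorphic to a disjoint (possibly empty) collection of circles. The framework $F(S)$ is the 1-skeleton of $S$: a finite connected graph without loops and multiple edges whose vertices $v_i$ are placed at points $p_i\in\mathbb{R}^2$ and whose edges are straight segments. Self-stresses. A stress $w$ on $F(S)$ assigns a real number $w_{ij}=w_{ji}$ to each edge $p_ip_j$ (also written $w(p_ip_j)$). It is a self-stress if $\sum_{\{j\,:\,v_iv_j \text{ an edge}\}} w_{ij}(p_i-p_j)=0$ at every vertex $v_i$. Face-paths. A face-path $\gamma$ of length $N\geq 1$ from $f_0$ to $f_N$ is a sequence of faces $(f_0,\dots,f_N)$ of $S$ together with a sequence of edges $(p_1q_1,\dots,p_Nq_N)$ such that $p_iq_i$ is a common edge of $f_{i-1}$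 and $f_i$ for all $i$ (if $f_{i-1}=f_i$, any edge of that face is allowed). A face is oriented if its edges are oriented so as to form an oriented loop. The orientations of two distinct faces agree at a common edge $e$ if their oriented edge loops pass $e$ in opposite directions. The face-path is oriented if each of its faces and edges is oriented so that the orientations of consecutive distinct faces $f_{i-1},f_i$ agree at $p_iq_i$ (a repeated face $f_{i-1}=f_i$ keeps its orientation), and the edge $p_iq_i$ is oriented from $p_i$ to $q_i$ by the orientation of $f_{i-1}$. Orientations are attached to the entries of the path, not to the faces of $S$, so on a non-orientable surface a path may visit the same face with opposite orientations. Lifts. For a step $i$ of an oriented face-path, the elementary lift is the linear (i.e. affine) function on $\mathbb{R}^2$ $$L_{f_{i-1}}^{f_i}(p)=\det(p_i-q_i,\;p_i-p)\cdot w(p_iq_i)\cdot\rho(f_{i-1},f_i),$$ where $\rho(f,g)=1$ if $f,g$ are different faces of $S$ and $\rho(f,g)=0$ otherwise. The lift from $f_0$ to $f_N$ with respect to $\gamma$ and $w$ is $\tau_{\gamma,w}(f_0,f_N)=\sum_{i=1}^N L_{f_{i-1}}^{f_i}$. Homotopy. Two oriented face-paths are homotopic if one is taken to the other by a finite sequence of the following moves and their inverses (orientations of the initial face and of retained entries are kept). (1) Between consecutive entries $f_i,f_{i+1}$ joined through an edge $e$, insert two copies $g,g$ of a face $g$ adjacent to $e$, where the steps $f_i\to g$ and $g\to f_{i+1}$ use the edge $e$, and the step $g\to g$ uses any edge of $g$. (2) Between consecutive entries $f_i,f_{i+1}$ joined through an edge $e$, insert $g_1,\dots,g_k$, a loop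 of all the faces around an endpoint $v$ of $e$, listed in cyclic order: $g_s$ and $g_{s+1}$ share an edge at $v$ through which the path passes, $g_k$ and $g_1$ share the edge $e$, and the steps $f_i\to g_1$ and $g_k\to f_{i+1}$ use the edge $e$. *)

(* Defs.v *)
From Stdlib Require Import Relation_Operators.
From HB Require Import structures.
From mathcomp Require Import all_boot all_order all_algebra.
From mathcomp Require Import reals.

Set Implicit Arguments.
Unset Strict Implicit.
Unset Printing Implicit Defensive.

Import Order.TTheory GRing.Theory Num.Theory.
Local Open Scope ring_scope.

(* The sides of the closed polygonal curve whose successive vertices are the
   items of c.  Since the 1-skeleton has no loops and no multiple edges, an
   edge is identified with the set of its two endpoints. *)
Definition sides (T : finType) (c : seq T) : {set {set T}} :=
  [set [set x; next c x] | x in c].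

(* Cell structure of a compact connected surface with (possibly empty)
   boundary, whose faces are polygons and whose 1-skeleton is a simple graph.
   Faces are labels, because two different faces may have the same boundary
   cycle.  The link of a vertex v has the edges at v as its nodes and the
   faces at v as its arcs: by edge_le2 its nodes have degree 1 or 2, so by
   link_connected it is an arc (boundary vertex) or a circle (interior
   vertex), which is the condition for the cell complex to be a surface. *)
Record cell_surface := CellSurface {
  vert : finType;
  face : finType;
  bdry : face -> seq vert;
  bdry_size : forall f, (2 < size (bdry f))%N;
  bdry_uniq : forall f, uniq (bdry f);
  vert_covered : forall v, exists f, v \in bdry f;
  edge_le2 : forall e : {set vert}, (#|[set f | e \in sides (bdry f)]| <= 2)%N;
  link_connected : forall v f g, v \in bdry f -> v \in bdry g ->
    connect [rel a b | [exists e : {set vert},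
      [&& v \in e, e \in sides (bdry a) & e \in sides (bdry b)]]] f g;
  skeleton_connected : forall x y,
    connect [rel a b | [exists f, [set a; b] \in sides (bdry f)]] x y
}.

(* The point with parameter t on the i-th side of the closed polygon s. *)
Definition side_point (R : realType) (s : seq 'rV[R]_2) (i : nat) (t : R) :
    'rV[R]_2 :=
  (1 - t) *: s`_i + t *: s`_(i.+1 %% size s).

(* The boundary curve, parametrized by half-open sides, is injective. The
   vertices of a polygon in the plane are automatically coplanar. *)
Definition flat_polygon (R : realType) (s : seq 'rV[R]_2) : Prop :=
  (2 < size s)%N /\
  forall (i j : nat) (t u : R),
    (i < size s)%N -> (j < size s)%N -> 0 <= t < 1 -> 0 <= u < 1 ->
    side_point s i t = side_point s j u -> i = j /\ t = u.

Record polygonal_surface (R : realType) := PolygonalSurface {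
  cells :> cell_surface;
  pos : vert cells -> 'rV[R]_2;
  face_flat : forall f : face cells, flat_polygon (map pos (bdry f))
}.

Section Lifts.
Variables (R : realType) (S : polygonal_surface R).

Definition adj (x y : vert S) : bool :=
  [exists f : face S, [set x; y] \in sides (bdry f)].

(* Only the values of w at adjacent pairs are meaningful. *)
Definition self_stress (w : vert S -> vert S -> R) : Prop :=
  (forall i j, adj i j -> w i j = w j i) /\
  (forall i, \sum_(j | adj i j) w i j *: (pos i - pos j) = 0).

(* A face with one of its two orientations: (f, true) runs through bdry f in
   the given cyclic order, (f, false) in the reverse order. *)
Definition oface : Type := (face S * bool)%type.

Definition oloop (a : oface) : seq (vert S) :=
  if a.2 then bdry a.1 else rev (bdry a.1).

(* An edge pq oriented from p to q. *)
Definition oedge : Type := (vert S * vert S)%type.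

Definition edge_of (d : oedge) : {set vert S} := [set d.1; d.2].

Definition passes (a : oface) (d : oedge) : bool :=
  (d.1 \in oloop a) && (d.2 == next (oloop a) d.1).

(* An admissible step from a to b through the edge d = (p, q), oriented by a. *)
Definition oriented_step (a : oface) (d : oedge) (b : oface) : bool :=
  passes a d && (if a.1 == b.1 then a.2 == b.2 else passes b (d.2, d.1)).

(* The sequences (f_0, ..., f_N) and (p_1 q_1, ..., p_N q_N) are stored as
   f_0 and the list of the pairs (p_i q_i, f_i). *)
Record face_path := FacePath {
  start : oface;
  steps : seq (oedge * oface)
}.

Fixpoint oriented_steps (a : oface) (s : seq (oedge * oface)) : bool :=
  if s is (d, b) :: s' then oriented_step a d b && oriented_steps b s'
  else true.

Definition oriented_face_path (c : face_path) : bool :=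
  (0 < size (steps c))%N && oriented_steps (start c) (steps c).

Definition finish (c : face_path) : oface := last (start c) (unzip2 (steps c)).

Definition path_from_to (c : face_path) (f f' : face S) : Prop :=
  (start c).1 = f /\ (finish c).1 = f'.

Definition elementary_lift (w : vert S -> vert S -> R)
    (f : face S) (d : oedge) (g : face S) (x : 'rV[R]_2) : R :=
  \det (col_mx (pos d.1 - pos d.2) (pos d.1 - x) : 'M[R]_2)
    * w d.1 d.2 * (f != g)%:R.

Fixpoint lift_steps (w : vert S -> vert S -> R) (a : oface)
    (s : seq (oedge * oface)) (x : 'rV[R]_2) : R :=
  if s is (d, b) :: s' then
    elementary_lift w a.1 d b.1 x + lift_steps w b s' x
  else 0.

Definition face_lift (c : face_path) (w : vert S -> vert S -> R) :
    'rV[R]_2 -> R :=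
  lift_steps w (start c) (steps c).

(* In both moves the step (d, b) through the edge e of d is replaced by steps
   whose first and last edges are e; d' is e with the orientation given by the
   last inserted face. *)
Definition move1 (c c' : face_path) : Prop :=
  exists s1 s2 d b g h d',
    [/\ c = FacePath (start c) (s1 ++ (d, b) :: s2),
        c' = FacePath (start c) (s1 ++ [:: (d, g); (h, g); (d', b)] ++ s2),
        edge_of d \in sides (bdry g.1),
        edge_of h \in sides (bdry g.1) &
        edge_of d' = edge_of d].

(* l = [:: (e_1, g_1); ...; (e_k, g_k)] lists each edge and each face at v
   once, in cyclic order: e_(s+1) is common to g_s and g_(s+1), and e_1 is
   common to g_k and g_1.  No such l exists when v is a boundary vertex. *)
Definition loop_around (v : vert S) (l : seq ({set vert S} * face S)) : Prop :=
  [/\ uniq (unzip1 l),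
      forall e, (e \in unzip1 l) =
        (v \in e) && [exists f : face S, e \in sides (bdry f)],
      uniq (unzip2 l),
      forall f, (f \in unzip2 l) = (v \in bdry f) &
      cycle [rel x y : {set vert S} * face S |
        (y.1 \in sides (bdry x.2)) && (y.1 \in sides (bdry y.2))] l].

Definition move2 (c c' : face_path) : Prop :=
  exists s1 s2 d b v g l d',
    [/\ c = FacePath (start c) (s1 ++ (d, b) :: s2),
        c' = FacePath (start c) (s1 ++ ((d, g) :: l) ++ (d', b) :: s2),
        v \in edge_of d,
        loop_around v [seq (edge_of t.1, t.2.1) | t <- (d, g) :: l] &
        edge_of d' = edge_of d].

Definition elementary_move (c c' : face_path) : Prop :=
  [/\ oriented_face_path c, oriented_face_path c' & move1 c c' \/ move2 c c'].

Definition homotopic : face_path -> face_path -> Prop :=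
  clos_refl_sym_trans face_path elementary_move.

End Lifts.

(* Main.v *)
(** Write [E d] for the affine function attached to an oriented edge [d];
    reversing [d] changes its sign.  In move 1 the two passages through the edge
    cancel, unless one of them is killed by a repeated face, because an edge lies
    on at most two faces.  In move 2 the orientations of the inserted faces agree
    along the loop, so the edges at [v] are all passed away from [v] or all
    towards [v]; hence the sum of [E] over them is, up to sign, the determinant
    of the stress at [v], which is balanced, against [pos v - x]. *)
Require Import Defs.
From mathcomp Require Import all_boot all_order all_algebra.
From mathcomp Require Import reals.
From mathcomp Require Import ring.
From Stdlib Require Import Relation_Operators.

Set Implicit Arguments.
Unset Strict Implicit.
Unset Printing Implicit Defensive.

Import GRing.Theory.
Local Open Scope ring_scope.

(** * Preliminaries on determinants, two-element sets and cyclic sequences *)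

Lemma det_col_mx2 (R : comNzRingType) (u v : 'rV[R]_2) :
  \det (col_mx u v : 'M[R]_2) = u 0 0 * v 0 1 - u 0 1 * v 0 0.
Proof.
have rowu j : col_mx u v (0 : 'I_2) j = u 0 j.
  by rewrite -(col_mxEu u v); congr (col_mx u v _ _); apply: val_inj.
have rowv j : col_mx u v (1 : 'I_2) j = v 0 j.
  by rewrite -(col_mxEd u v); congr (col_mx u v _ _); apply: val_inj.
rewrite (expand_det_row _ 0) !big_ord_recl big_ord0 addr0 /cofactor !det_mx11.
rewrite !(mxE matrix_key).
have l1 i : lift 0 i = 1 :> 'I_2 by rewrite (ord1 i); apply: val_inj.
have l0 i : lift 1 i = 0 :> 'I_2 by rewrite (ord1 i); apply: val_inj.
rewrite !l1 !l0 !rowu !rowv.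
by rewrite expr0 expr1 mul1r mulN1r mulrN.
Qed.

Lemma set2_injr (T : finType) (x y z : T) : [set x; y] = [set x; z] -> y = z.
Proof.
move=> /setP E; have := E y; have := E z; rewrite !inE !eqxx !orbT.
by case: (eqVneq y z) => // nyz; rewrite !orbF => /eqP-> /esym/eqP->.
Qed.

(** Rotating [x] to the front leaves [x :: y :: z :: r], so the second successor is [z], distinct
    from [x]. For a cycle of length two it would be [x] again. *)
Lemma next_next_neq (T : eqType) (c : seq T) x :
  uniq c -> (2 < size c)%N -> x \in c -> next c (next c x) != x.
Proof.
move=> Uc c2 /rot_to[i [|y [|z r]] def_c]; try by rewrite -(size_rot i) def_c in c2.
rewrite -!(next_rot i Uc) def_c /= !eqxx.
have := Uc; rewrite -(rot_uniq i) def_c /= !inE !negb_or.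
move=> /and3P[/and3P[xy xz _] _ _].
by rewrite [y == x]eq_sym (negPf xy) eq_sym.
Qed.

Lemma sides_rev (T : finType) (c : seq T) : uniq c -> sides (rev c) = sides c.
Proof.
move=> Uc; apply/setP=> e; apply/imsetP/imsetP => -[x xc ->].
  exists (prev c x); first by rewrite mem_prev -mem_rev.
  by rewrite next_prev // next_rev // setUC.
exists (next c x); first by rewrite mem_rev mem_next.
by rewrite next_rev // prev_next // setUC.
Qed.

(** * How oriented faces pass through edges *)

Section Passing.
Variables (R : realType) (S : polygonal_surface R).
Implicit Types (a b : oface S) (d : oedge S) (v : vert S).

Definition flip d : oedge S := (d.2, d.1).

Lemma edge_of_flip d : edge_of (flip d) = edge_of d.
Proof. exact: setUC. Qed.

Lemma edge_of_eq d d' : edge_of d = edge_of d' -> d = d' \/ d = flip d'.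
Proof.
case: d d' => [p q] [p' q']; rewrite /edge_of /flip /= => E.
have: p \in [set p'; q'] by rewrite -E set21.
rewrite !inE => /orP[] /eqP def_p; rewrite {}def_p in E *; [left | right].
  by rewrite (set2_injr E).
by rewrite setUC in E; rewrite [q](@set2_injr _ q' q p') // setUC E setUC.
Qed.

Lemma oloop_uniq a : uniq (oloop a).
Proof. by rewrite /oloop; case: a.2; rewrite ?rev_uniq bdry_uniq. Qed.

Lemma oloop_size a : (2 < size (oloop a))%N.
Proof. by rewrite /oloop; case: a.2; rewrite ?size_rev bdry_size. Qed.

Lemma passes_side a d : passes a d -> edge_of d \in sides (bdry a.1).
Proof.
case/andP=> da /eqP da2.
have -> : sides (bdry a.1) = sides (oloop a).
  by rewrite /oloop; case: a.2; rewrite // sides_rev // bdry_uniq.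
by apply/imsetP; exists d.1; rewrite /edge_of ?da2.
Qed.

Lemma passes_adj a d : passes a d -> adj d.1 d.2.
Proof. by move/passes_side=> da; apply/existsP; exists a.1. Qed.

(** Passing an edge both ways would make [next] return to its starting vertex after two steps,
    impossible on a polygon with at least three vertices. *)
Lemma passes_asym a d : passes a d -> ~~ passes a (flip d).
Proof.
case/andP=> da /eqP da2; apply/nandP; right; rewrite /= da2 eq_sym.
exact: next_next_neq (oloop_uniq a) (oloop_size a) da.
Qed.

Lemma passes_edge_inj a d d' :
  passes a d -> passes a d' -> edge_of d = edge_of d' -> d = d'.
Proof.
by move=> da d'a /edge_of_eq[] // E; move: (passes_asym d'a); rewrite -E da.
Qed.

Lemma passes_neq a d : passes a d -> d.1 != d.2.
Proof.
move=> da; apply/eqP=> E; move: (passes_asym da).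
by case: d da E => p q /[swap] /= ->; rewrite /flip /= => ->.
Qed.

(* An oriented face enters each of its vertices once and leaves it once. *)
Lemma passes_source a d d' v :
  passes a d -> passes a d' -> edge_of d != edge_of d' ->
  v \in edge_of d -> v \in edge_of d' -> (d'.1 == v) = (d.1 != v).
Proof.
case: d d' => [p q] [p' q'] /=; rewrite !inE /edge_of /=.
move=> da d'a nE /orP[]/eqP vd /orP[]/eqP vd'; subst.
- case/andP: da d'a nE => /= _ /eqP-> /andP[/= _ /eqP->].
  by rewrite eqxx.
- by rewrite eqxx (negPf (passes_neq d'a)).
- by rewrite eqxx /= (passes_neq da).
- case/andP: da d'a nE => /= _ /eqP qE /andP[/= _ /eqP].
  by rewrite qE => /(can_inj (prev_next (oloop_uniq a)))->; rewrite eqxx.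
Qed.

(** A third face would contradict [edge_le2]. This settles the coincidences among the faces that a
    move brings together at one edge. *)
Lemma side_two_faces (e : {set vert S}) (f g h : face S) :
  e \in sides (bdry f) -> e \in sides (bdry g) -> e \in sides (bdry h) ->
  f != g -> h != g -> f = h.
Proof.
move=> ef eg eh nfg nhg; apply/eqP/negPn/negP=> nfh.
suff: (2 < #|[set f | e \in sides (bdry f)]|)%N by rewrite ltnNge edge_le2.
by apply/card_gt2P; exists f, g, h; rewrite !inE nfg (eq_sym g) nhg eq_sym.
Qed.

Lemma oriented_steps_cat a (s1 s2 : seq (oedge S * oface S)) :
  oriented_steps a (s1 ++ s2) =
  oriented_steps a s1 && oriented_steps (last a (unzip2 s1)) s2.
Proof. by elim: s1 a => //= -[d b] s1 IH a; rewrite IH andbA. Qed.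

Lemma oriented_step_side a d b :
  oriented_step a d b -> edge_of d \in sides (bdry b.1).
Proof.
case/andP=> da; case: eqP => [<- _|_]; first exact: passes_side.
by rewrite -edge_of_flip; apply: passes_side.
Qed.

Lemma oriented_step_eq a d b : oriented_step a d b -> a.1 = b.1 -> a = b.
Proof.
by case: a b => [f o] [g o'] /andP[_ /=] /[swap] ->; rewrite eqxx => /eqP->.
Qed.

Lemma oriented_step_neq a d b :
  oriented_step a d b -> a.1 != b.1 -> passes b (flip d).
Proof. by case/andP=> _ /[swap] /negPf->. Qed.

End Passing.

(** * Lifts around a vertex in equilibrium *)

Section Stress.
Variables (R : realType) (S : polygonal_surface R).
Variables (w : vert S -> vert S -> R) (x : 'rV[R]_2).
Hypothesis w_stress : self_stress w.
Implicit Types (a b : oface S) (d : oedge S) (v : vert S).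

(** The elementary lift without its factor rho: it depends on the oriented edge alone, so passages
    between different faces can be compared. *)
Definition edge_lift d : R :=
  \det (col_mx (pos d.1 - pos d.2) (pos d.1 - x) : 'M[R]_2) * w d.1 d.2.

Lemma elementary_liftE f d g :
  elementary_lift w f d g x = edge_lift d * (f != g)%:R.
Proof. by []. Qed.

(** Moving the base point from one endpoint to the other changes the second row by a multiple of the
    first, so only the sign of the first row matters. *)
Lemma edge_lift_flip d : adj d.1 d.2 -> edge_lift (flip d) = - edge_lift d.
Proof.
case: w_stress => w_sym _ /w_sym wE; rewrite /edge_lift /= -wE.
by rewrite !det_col_mx2 !mxE; ring.
Qed.

Lemma lift_steps_cat a (s1 s2 : seq (oedge S * oface S)) :
  lift_steps w a (s1 ++ s2) x =
  lift_steps w a s1 x + lift_steps w (last a (unzip2 s1)) s2 x.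
Proof. by elim: s1 a => [|[d b] s1 IH] a /=; rewrite ?add0r // IH addrA. Qed.

(** With all edges leaving [v], the second row [pos v - x] is the same in every determinant and
    factors out. What remains is the balance at [v], read coordinatewise. *)
Lemma sum_edge_lift_star v : \sum_(j | adj v j) edge_lift (v, j) = 0.
Proof.
case: w_stress => _ /(_ v) /matrixP bal.
have bal_i i : \sum_(j | adj v j) w v j * (pos v 0 i - pos j 0 i) = 0.
  by have := bal 0 i; rewrite mxE summxE => {2}<-; apply: eq_bigr => j _; rewrite !mxE.
transitivity (\sum_(j | adj v j) (
    w v j * (pos v 0 0 - pos j 0 0) * (pos v - x) 0 1
    - w v j * (pos v 0 1 - pos j 0 1) * (pos v - x) 0 0)).
  by apply: eq_bigr => j _; rewrite /edge_lift /= det_col_mx2 !mxE; ring.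
by rewrite sumrB -!mulr_suml !bal_i !mul0r subrr.
Qed.

Lemma sum_edge_lift_coherent v (o : bool) (ds : seq (oedge S)) :
  {in ds, forall d, adj d.1 d.2 /\ v \in edge_of d} ->
  {in ds, forall d, (d.1 == v) = o} ->
  uniq (map (@edge_of R S) ds) ->
  (forall j, adj v j -> [set v; j] \in map (@edge_of R S) ds) ->
  \sum_(d <- ds) edge_lift d = 0.
Proof.
move=> ds_v ds_o Uds ds_adj.
(* The flag [o] tells whether all edges leave [v] or all enter it; [other d] is the far endpoint in
   either case. *)
pose other d := if o then d.2 else d.1.
have edgeE d : d \in ds -> edge_of d = [set v; other d].
  move=> dds; have [_] := ds_v d dds; have := ds_o d dds.
  rewrite /other /edge_of !inE; case: (o) => [/eqP-> //|].
  by rewrite eq_sym => -> /= /eqP ->; rewrite setUC.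
have liftE d : d \in ds -> edge_lift d = (-1) ^+ (~~ o) * edge_lift (v, other d).
  move=> dds; have [ad] := ds_v d dds; have := ds_o d dds.
  case: d ad {dds} => p q; rewrite /other !inE /=; case: (o) => [ad /eqP-> _|ad].
    by rewrite expr0 mul1r.
  rewrite eq_sym => -> /= /eqP ->; rewrite expr1 mulN1r.
  by rewrite (@edge_lift_flip (p, q)) // opprK.
rewrite (eq_big_seq _ liftE) -mulr_sumr.
rewrite -(big_map other predT (fun j => edge_lift (v, j))) big_uniq; last first.
  (* Far endpoints are distinct because the edges they span with [v] are. *)
  apply: (@map_uniq _ _ (fun j => [set v; j])); rewrite -map_comp.
  by have /eq_in_map <- := edgeE.
rewrite (eq_bigl (adj v)) ?sum_edge_lift_star ?mulr0 // => j.
apply/mapP/idP => [[d dds ->]|/ds_adj/mapP[d dds E]].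
  have [/existsP[f ad] _] := ds_v d dds; apply/existsP; exists f.
  by rewrite -edgeE.
by exists d => //; apply: (@set2_injr _ v); rewrite E edgeE.
Qed.

(** The faces are distinct, so no factor rho vanishes. The edge [d'], passed by the last face,
    stands for the step that leaves the loop; it completes the star of [v]. *)
Lemma lift_steps_around v g (l : seq (oedge S * oface S)) d' :
  let ds := rcons (unzip1 l) d' in
  oriented_steps g l -> passes (last g (unzip2 l)) d' ->
  uniq (map fst (g :: unzip2 l)) ->
  {in ds, forall d, v \in edge_of d} ->
  uniq (map (@edge_of R S) ds) ->
  [/\ lift_steps w g l x + edge_lift d' = \sum_(d <- ds) edge_lift d,
      {in ds, forall d, adj d.1 d.2} &
      {in ds, forall d, (d.1 == v) = ((head d' ds).1 == v)}].
Proof.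
elim: l g => [|[d b] l IH] g /=.
  move=> _ d'g _ _ _; rewrite add0r big_seq1.
  by split=> // d; rewrite inE => /eqP-> //; apply: passes_adj d'g.
move=> /andP[sgb lb] lastd' /andP[ngl Ul] vds /andP[nd Uds].
have ngb : g.1 != b.1 by move: ngl; rewrite inE negb_or => /andP[].
have [] := IH b lb lastd' Ul _ Uds.
  by move=> e eds; apply: vds; rewrite inE eds orbT.
set ds := rcons _ _ in vds nd Uds * => sumE adjE srcE.
have dg : passes g d by case/andP: sgb.
have db := oriented_step_neq sgb ngb.
have hdb : passes b (head d' ds).
  rewrite /ds; case: (l) lb lastd' => [|[e c] l'] //= /andP[/andP[]] //.
have hds : head d' ds \in ds by rewrite /ds headI inE eqxx.
(* Face [b] passes [flip d] and then the next edge. The reversal and [passes_source] each exchange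
   leaving [v] and entering [v], so the two changes cancel. *)
have hd_v : ((head d' ds).1 == v) = (d.1 == v).
  rewrite (passes_source (d := flip d) db hdb) ?edge_of_flip.
  - have := vds d (mem_head _ _); rewrite !inE /= => /orP[] /eqP->.
      by rewrite eqxx eq_sym (passes_neq dg).
    by rewrite eqxx (negPf (passes_neq dg)).
  - by apply: contra nd => /eqP->; apply: map_f.
  - by apply: vds; apply: mem_head.
  - by apply: vds; rewrite inE hds orbT.
split.
- by rewrite big_cons elementary_liftE ngb mulr1 -sumE addrA.
- by move=> e; rewrite inE => /predU1P[->|/adjE//]; apply: passes_adj dg.
- by move=> e; rewrite inE => /predU1P[->//|/srcE->].
Qed.

(** The full sum over the star vanishes, so the steps inside the loop contribute minus the closing
    edge. The second part compares the direction of [d'] with that in which [g] passes the same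
    edge. *)
Lemma edge_lift_around v d g (l : seq (oedge S * oface S)) d' :
  oriented_steps g l -> passes (last g (unzip2 l)) d' ->
  v \in edge_of d -> edge_of d' = edge_of d ->
  loop_around v [seq (edge_of t.1, t.2.1) | t <- (d, g) :: l] ->
  lift_steps w g l x = - edge_lift d' /\
  (edge_lift d' = 0 \/
   g.1 != (last g (unzip2 l)).1 /\
   forall d0, passes g d0 -> edge_of d0 = edge_of d -> d' = flip d0).
Proof.
move=> lg lastd' vd d'E [].
rewrite /unzip1 /unzip2 -!map_comp => Ue coverE Uf _ _.
(* Dropping [d] at the head and adding [d'] at the end rotates the cyclic list of edges, so that
   each edge is paired with the face that passes it on leaving. *)
pose ds := rcons (unzip1 l) d'.
have memE : map (@edge_of R S) ds =i
    [seq edge_of t.1 | t <- (d, g) :: l].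
  by move=> e; rewrite /ds map_rcons mem_rcons d'E /unzip1 -map_comp.
have Uds : uniq (map (@edge_of R S) ds).
  by rewrite /ds map_rcons rcons_uniq d'E /unzip1 -map_comp.
have vds : {in ds, forall e, v \in edge_of e}.
  move=> e eds; have : edge_of e \in map (@edge_of R S) ds by apply: map_f.
  by rewrite memE coverE => /andP[].
have Ugl : uniq (map fst (g :: unzip2 l)) by rewrite /= /unzip2 -map_comp.
have [sumE adjE srcE] := lift_steps_around lg lastd' Ugl vds Uds.
have lE : lift_steps w g l x = - edge_lift d'.
  apply/eqP; rewrite -addr_eq0 sumE; apply/eqP.
  apply: (sum_edge_lift_coherent (v := v) _ srcE) => // [e eds|j vj].
    by split; [apply: adjE | apply: vds].
  by rewrite memE coverE set21.
split=> //.
clear coverE memE Uds Uf sumE adjE.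
(* If [l] is empty, the lift is an empty sum and [lE] gives [edge_lift d' = 0]. *)
case: l => [|[e b] l] in lg lastd' Ue Ugl @ds vds srcE lE *.
  by left; apply/eqP; rewrite -oppr_eq0 -lE.
right; split.
  case/andP: Ugl => ngl _; apply: contra ngl => /eqP->.
  exact: (map_f fst (mem_last b (unzip2 l))).
move=> d0 d0g d0E; have eg : passes g e by case/andP: lg => /andP[].
(* By [srcE], [d'] and [e] have the same direction relative to [v], whereas [g] passes [d0] and [e]
   in opposite ones. *)
have : d0 <> d'.
  have d'ds : d' \in ds by rewrite mem_rcons mem_head.
  move=> d0d'; have /= := srcE d' d'ds; rewrite -d0d'.
  rewrite (passes_source (v := v) d0g eg) ?d0E //; first by case: eqP.
    by case/andP: Ue; rewrite inE negb_or => /andP[].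
  by apply: vds; apply: mem_head.
by case/esym/edge_of_eq: (etrans d'E (esym d0E)) => [->//|->] _; case: (d').
Qed.

End Stress.

(** * Invariance under the two moves *)

Section Moves.
Variables (R : realType) (S : polygonal_surface R).
Variables (w : vert S -> vert S -> R) (x : 'rV[R]_2).
Hypothesis w_stress : self_stress w.

Let E := edge_lift w x.

Lemma move1_lift (c c' : face_path S) :
  oriented_face_path c -> oriented_face_path c' -> move1 c c' ->
  face_lift c w x = face_lift c' w x.
Proof.
move=> /andP[_ oc] /andP[_ oc'] [s1 [s2 [d [b [g [h [d' [cE c'E _ _ d'E]]]]]]]].
move: oc oc'; rewrite {}c'E {}cE /face_lift /=.
rewrite !oriented_steps_cat !lift_steps_cat /=.
set a := last _ _ => /and3P[_ ab _] /andP[_ /and4P[ag _ gb _]].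
congr (_ + _); rewrite !elementary_liftE !addrA eqxx mulr0 addr0; congr (_ + _).
have da : passes a d by case/andP: ab.
have dg' : passes g d' by case/andP: gb.
(* If [g] repeats the face of [a], it keeps the orientation: the first inserted step is zero,
   [d' = d], and the last step reproduces the removed one. *)
case: (eqVneq a.1 g.1) => [aEg|nag].
  move: (oriented_step_eq ag aEg) dg' => <- dg'.
  by rewrite mulr0 add0r (passes_edge_inj dg' da d'E).
have -> : d' = flip d.
  by apply: passes_edge_inj dg' (oriented_step_neq ag nag) _; rewrite edge_of_flip.
rewrite (edge_lift_flip _ w_stress (passes_adj da)) mulr1.
case: (eqVneq g.1 b.1) => [<-|ngb]; first by rewrite nag mulr1 mulr0 addr0.
(* Here [a] and [b] both differ from [g], so they are the same face: the removed step is zero and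
   the two inserted passages cancel. *)
have -> : a.1 = b.1.
  apply: (side_two_faces (e := edge_of d) (g := g.1)); rewrite // 1?eq_sym //.
  - exact: passes_side.
  - exact: oriented_step_side ag.
  - exact: oriented_step_side ab.
by rewrite eqxx mulr0 mulr1 subrr.
Qed.

Lemma move2_lift (c c' : face_path S) :
  oriented_face_path c -> oriented_face_path c' -> move2 c c' ->
  face_lift c w x = face_lift c' w x.
Proof.
move=> /andP[_ oc] /andP[_ oc'].
move=> [s1 [s2 [d [b [v [g [l [d' [cE c'E vd lv d'E]]]]]]]]].
move: oc oc'; rewrite {}c'E {}cE /face_lift /=.
rewrite !oriented_steps_cat !lift_steps_cat /=.
rewrite oriented_steps_cat lift_steps_cat /=.
set a := last _ (unzip2 s1); set h := last g (unzip2 l).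
move=> /and3P[_ ab _] /and3P[_ ag /and3P[lg hb _]].
congr (_ + _); rewrite !addrA; congr (_ + _); rewrite !elementary_liftE.
have da : passes a d by case/andP: ab.
have dh : passes h d' by case/andP: hb.
have [-> gh] := edge_lift_around x w_stress lg dh vd d'E lv.
have flipE := edge_lift_flip x w_stress (passes_adj da).
rewrite -/E -/h in gh flipE *.
have gs := oriented_step_side ag.
have hs : edge_of d \in sides (bdry h.1) by rewrite -d'E; apply: passes_side.
have bs := oriented_step_side ab.
case: gh => [d'0|[ngh d'_flip]].
  (* [d] is [d'] or its reverse, so both sides vanish. *)
  have -> : E d = 0.
    case/edge_of_eq: d'E d'0 => ->; rewrite ?flipE // => /eqP.
    by rewrite oppr_eq0 => /eqP.
  by rewrite d'0 !mul0r subrr addr0.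
(* Now [g] and [h] are the two faces at the edge, so [a] is one of them. If it is [g], then [d'] is
   [d] reversed, and [b] may be [g] or [h]. *)
case: (eqVneq a.1 g.1) => [aEg|nag].
  have dg : passes g d by rewrite -(oriented_step_eq ag aEg).
  rewrite (d'_flip d dg erefl) flipE aEg mulr0 add0r opprK.
  case: (eqVneq g.1 b.1) => [<-|ngb].
    by rewrite eq_sym ngh mulr0 mulr1 subrr.
  have -> : b.1 = h.1.
    by apply: (side_two_faces (e := edge_of d) (g := g.1)); rewrite // eq_sym.
  by rewrite eqxx mulr0 addr0 mulr1.
(* If [a] is [h], then [d' = d]: entering the loop cancels its inner steps, and the last step equals
   the removed one. *)
have dg := oriented_step_neq ag nag.
have -> : d' = d by rewrite (d'_flip _ dg) ?edge_of_flip //; case: (d).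
have -> : a.1 = h.1.
  apply: (side_two_faces (e := edge_of d) (g := g.1)); rewrite // 1?eq_sym //.
  exact: passes_side.
by rewrite mulr1 subrr add0r.
Qed.

Lemma homotopic_lift (c c' : face_path S) :
  homotopic c c' -> face_lift c w x = face_lift c' w x.
Proof.
elim=> [c1 c2 [oc1 oc2 [m|m]]|//|c1 c2 _ -> //|c1 c2 c3 _ -> _ -> //].
  exact: move1_lift.
exact: move2_lift.
Qed.

End Moves.

Theorem theorem2p8 (R : realType) (S : polygonal_surface R)
    (w : vert S -> vert S -> R) (hw : self_stress w)
    (f f' : face S) (c c' : face_path S)
    (hc : oriented_face_path c) (hc' : oriented_face_path c')
    (hcf : path_from_to c f f') (hcf' : path_from_to c' f f')
    (hcc' : homotopic c c') :
  forall x : 'rV[R]_2, face_lift c w x = face_lift c' w x.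
Proof. by move=> x; apply: homotopic_lift. Qed.
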